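(* For every integer $m>3$ and every irrational $\beta\in[0,1]$, there exists an exchange of $m$ intervals $T_\beta$ such that: $T_\beta$ is uniquely ergodic; $T_\beta$ satisfies Keane's idoc condition; and $T_\beta$ is not topologically weakly mixing, the operator $U_{T_\beta}$ having non-constant continuous eigenfunctions associated to the eigenvalue $\exp(2i\pi\beta)$.
   Context: Let $r>0$ and $m>0$ be integers and $I^r=[0,r)$. An exchange of $m$ intervals of $I^r$ is a bijection $T:I^r\to I^r$ for which there exist a subdivision $a_0=0<a_1<\dots<a_m=r$ and reals $\delta_1,\dots,\delta_m$ with $T(x)=x+\delta_i$ for all $x\in[a_{i-1},a_i)$, $1\le i\le m$. The set $D(T)=\{a_1,\dots,a_{m-1}\}$ is called the set of discontinuities of $T$. Let $\mu$ be Lebesgue measure on $I=I^r$. The operator $U_T:L^2(I,\mu)\to L^2(I,\mu)$ is $U_T(f)=f\circ T$, where functions are complex valued. For $a\in\mathbb{C}$, a function $f\in L^2(I,\mu)$ (nonzero, as usual) is an eigenfunction of $U_T$ associated to the eigenvalue $a$ if $f\circ T=af$ $\mu$-almost everywhere. $T$ is uniquely ergodic if $\mu$ (normalized) is the only $T$-invariant probability measure. $T$ is topologically weakly mixing if the only continuous eigenfunctions of $U_T$ (continuous on $I$) are the constants. $T$ satisfies the idoc condition if (a) the orbit $O(a_i)=\{T^n(a_i):n\in\mathbb{Z}\}$ is infinite for every $1\le i\le m-1$, and (b) $O(a_i)\cap O(a_j)=\emptyset$ for all $1\le i,j\le m-1$ with $i\ne j$. *)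

(* Defs.v *)
From mathcomp Require Import all_boot all_order all_algebra complex.
From mathcomp Require Import all_classical all_reals all_analysis.

Set Implicit Arguments.
Unset Strict Implicit.
Unset Printing Implicit Defensive.

Import Order.TTheory GRing.Theory Num.Theory.
Import numFieldNormedType.Exports.

Local Open Scope classical_set_scope.
Local Open Scope ring_scope.

Definition Ir (R : realType) (r : nat) : set R := `[0, r%:R[.

Arguments Ir : clear implicits.

(* Maps of I^r, and functions on I^r, are represented by functions on the whole
   of R of which only the values on I^r matter.

   The pieces are indexed from 0, so that a 0 = 0 < a 1 < ... < a m = r and
   d i is the translation on [a i, a i.+1).  The last clause makes a 1, ...,
   a m.-1 the actual discontinuities of T : without it the subdivision, hence
   the number of intervals and the idoc condition below, would not be
   determined by T (one could insert arbitrary fake cut points). *)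
Definition interval_exchange (R : realType) (r m : nat)
    (T : R -> R) (a d : nat -> R) : Prop :=
  [/\ set_bij (Ir R r) (Ir R r) T,
      a 0%N = 0 /\ a m = r%:R,
      forall i, (i < m)%N -> a i < a i.+1,
      forall i, (i < m)%N -> forall x, x \in `[a i, a i.+1[ -> T x = x + d i
    & forall i, (i.+1 < m)%N -> d i <> d i.+1].

(* T ^ n for n : int; pinv (Ir R r) T is the inverse of the bijection T of
   I^r. *)
Definition ziter (R : realType) (r : nat) (T : R -> R) (n : int) (x : R) : R :=
  match n with
  | Posz k => iter k T x
  | Negz k => iter k.+1 (pinv (Ir R r) T) x
  end.

Definition orbit (R : realType) (r : nat) (T : R -> R) (x : R) : set R :=
  [set ziter r T n x | n in [set: int]].

Definition idoc (R : realType) (r m : nat) (T : R -> R) (a : nat -> R) : Prop :=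
  (forall i, (0 < i < m)%N -> infinite_set (orbit r T (a i))) /\
  (forall i j, (0 < i < m)%N -> (0 < j < m)%N -> i <> j ->
     orbit r T (a i) `&` orbit r T (a j) = set0).

Definition invariant_measure (R : realType) (r : nat) (T : R -> R)
    (nu : set R -> \bar R) : Prop :=
  forall A : set R, measurable A -> A `<=` Ir R r ->
    nu (Ir R r `&` T @^-1` A) = nu A.

Definition normalized_lebesgue (R : realType) (r : nat) (A : set R) : \bar R :=
  ((r%:R^-1)%:E * lebesgue_measure A)%E.

(* A Borel probability measure on I^r is a Borel probability measure on R
   which gives mass 1 to I^r. *)
Definition uniquely_ergodic (R : realType) (r : nat) (T : R -> R) : Prop :=
  invariant_measure r T (@normalized_lebesgue R r) /\
  forall nu : probability (measurableTypeR R) R,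
    nu (Ir R r) = 1%E -> invariant_measure r T nu ->
    forall A : set R, measurable A -> A `<=` Ir R r ->
      nu A = normalized_lebesgue r A.

Definition complex_L2 (R : realType) (r : nat) (f : R -> R[i]^o) : Prop :=
  [/\ measurable_fun (Ir R r) (fun x => complex.Re (f x)),
      measurable_fun (Ir R r) (fun x => complex.Im (f x))
    & lebesgue_measure.-integrable (Ir R r)
        (fun x => (complex.Re `|f x| ^+ 2)%:E)].

Definition eigenfunction (R : realType) (r : nat) (T : R -> R)
    (c : R[i]) (f : R -> R[i]^o) : Prop :=
  [/\ complex_L2 r f,
      ~ {ae lebesgue_measure, forall x, Ir R r x -> f x = 0}
    & {ae lebesgue_measure, forall x, Ir R r x -> f (T x) = c * f x}].

Definition constant_on_Ir (R : realType) (r : nat) (f : R -> R[i]^o) : Prop :=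
  exists k : R[i], forall x, Ir R r x -> f x = k.

Definition topologically_weakly_mixing (R : realType) (r : nat)
    (T : R -> R) : Prop :=
  forall (c : R[i]) (f : R -> R[i]^o),
    eigenfunction r T c f -> {within Ir R r, continuous f} ->
    constant_on_Ir r f.

(* exp(2 i pi beta) *)
Definition exp2ipi (R : realType) (beta : R) : R[i] :=
  (cos (2 * pi * beta) +i* sin (2 * pi * beta))%C.

(* Main.v *)
Require Import Defs.
From mathcomp Require Import all_boot all_order all_algebra complex.
From mathcomp Require Import all_classical all_reals all_analysis.
From mathcomp Require Import measurable_realfun.
From mathcomp Require Import zify ring lra.
Import Order.TTheory GRing.Theory Num.Theory.
Import numFieldNormedType.Exports.
Local Open Scope classical_set_scope.
Local Open Scope ring_scope.
Set Implicit Arguments.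
Unset Strict Implicit.
Unset Printing Implicit Defensive.

(** The exchange.  Put r = m - 1 >= 3.  Rotate the circle of length r by beta,
    then permute its unit intervals [j, j + 1) by j -> 1 - j mod r
    ([flip_map]).  Every point x is sent to x + beta plus an integer, so
    x -> exp (2 i pi x) is a continuous eigenfunction for exp (2 i pi beta).
    The permutation reverses the cyclic order and r >= 3, so the translation
    does jump at each of the r points k - beta, 1 <= k <= r; with the end
    points 0 and r this makes m intervals.  These points differ by nonzero integers,
    while T^n moves every point by n beta plus an integer: since beta is
    irrational, T^n a_i = T^n' a_j forces n = n', hence a_i = a_j.  This is the
    idoc condition.

    Unique ergodicity is Boshernitzan's argument.  It rests on two facts.
    - There are arbitrarily small delta and integers n >= 1 / (2 delta) such
      that the multiples i beta, 0 < i < n, stay at distance at least delta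
      from the integers ([well_spaced_orbit]).
    - T is a translation on [x, x + h) as soon as x + beta is followed by no
      integer within h.  When h <= delta, the translates by i beta of
      (x, x + h) contain an integer for at most one i in a time window of
      length n; hence either the n / 2 first images of [x, x + h), or its
      n / 2 first preimages, are disjoint translates of it
      ([disjoint_translates]).

    Suppose an invariant set E has intermediate density theta in [0, r).  By
    the intermediate value theorem some interval of length h ~ delta meets E in
    the proportion theta exactly; so do its n / 2 translates, whose total
    length is bounded below independently of delta.  This contradicts the fact
    that on most short intervals a measurable set is nearly full or nearly
    empty.  So E is null or conull for Lebesgue measure
    ([invariant_zero_one]).

    Let nu be an invariant probability measure.  A set of diameter less than
    delta has n disjoint preimages of the same nu-measure, so nu gives mass at
    most 2 l to an interval of length l, and is absolutely continuous.  A set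
    that maximizes nu - Lebesgue / r, given by the Hahn decomposition, can be
    enlarged to an invariant one; the zero-one law then shows that the maximum
    is 0, that is, nu is normalized Lebesgue measure. *)

(** * Well-spaced orbits of irrational rotations *)

Lemma irrational_mulrn_neq_int (R : realType) (beta : R) (n : nat) (p : int) :
  irrational beta -> (0 < n)%N -> n%:R * beta != p%:~R.
Proof.
move=> irr n0; apply/negP => /eqP e; apply: irr.
exists (p%:~R / n%:R) => //=.
rewrite fmorph_div/= ratr_int ratr_nat -e mulrC mulKf//.
by rewrite pnatr_eq0 -lt0n.
Qed.

Definition int_dist (R : realType) (x : R) : R :=
  Num.min (x - (Num.floor x)%:~R) ((Num.floor x)%:~R + 1 - x).

Lemma int_dist_le (R : realType) (x : R) (p : int) :
  int_dist x <= `|x - p%:~R|.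
Proof.
rewrite /int_dist ge_min.
have /andP[fx xf] := floor_itv x.
have [pf|fp] := leP p (Num.floor x).
  apply/orP; left; have : (p%:~R : R) <= (Num.floor x)%:~R by rewrite ler_int.
  by move=> ?; rewrite ger0_norm; lra.
apply/orP; right.
have : ((Num.floor x + 1)%:~R : R) <= p%:~R by rewrite ler_int lezD1.
rewrite intrD => ?; rewrite intrD in xf; rewrite ltr0_norm; lra.
Qed.

Lemma int_dist_attained (R : realType) (x : R) :
  exists p : int, int_dist x = `|x - p%:~R|.
Proof.
have /andP[fx xf] := floor_itv x; rewrite intrD in xf.
rewrite /int_dist /Num.min; case: ifP => _.
  by exists (Num.floor x); rewrite ger0_norm; lra.
by exists (Num.floor x + 1); rewrite intrD ler0_norm; lra.
Qed.

(** Pigeonhole: two of the N + 1 fractional parts of i x, 0 <= i <= N, lie in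
    the same interval of length 1 / N. *)
Lemma dirichlet_approximation (R : realType) (x : R) (N : nat) : (0 < N)%N ->
  exists2 q : nat, (0 < q <= N)%N & int_dist (q%:R * x) < N%:R^-1.
Proof.
move=> N0; pose y (i : nat) : R := i%:R * x - (Num.floor (i%:R * x))%:~R.
have Npos : (0 : R) < N%:R by rewrite ltr0n.
have y01 i : 0 <= y i < 1.
  by rewrite /y; have := floor_itv (i%:R * x); rewrite intrD => /andP[]; lra.
have bin_lt (i : 'I_N.+1) : (`|Num.floor (N%:R * y i)| < N)%N.
  have /andP[y0 y1] := y01 i.
  have f0 : (0 <= Num.floor (N%:R * y i))%R.
    by rewrite floor_ge0 mulr_ge0// ltW.
  by rewrite -ltz_nat gez0_abs// floor_lt_int -[X in _ < X]pmulrn gtr_pMr.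
pose b (i : 'I_N.+1) : 'I_N := Ordinal (bin_lt i).
have /injectivePn[i [j ij bij]] : ~~ injectiveb b.
  apply/negP => /injectiveP/leq_card; rewrite !card_ord; lia.
wlog lij : i j ij bij / (i < j)%N.
  move=> H; have : (i < j)%N || (j < i)%N by rewrite -neq_ltn.
  by case/orP => l; [exact: (H i j)|apply: (H j i) => //; rewrite eq_sym].
exists (j - i)%N; first by have := ltn_ord j; lia.
have {}bij : Num.floor (N%:R * y i) = Num.floor (N%:R * y j).
  have /andP[yi0 _] := y01 i; have /andP[yj0 _] := y01 j.
  move/(congr1 val): bij => /=.
  have fi0 : (0 <= Num.floor (N%:R * y i))%R.
    by rewrite floor_ge0 mulr_ge0// ltW.
  have fj0 : (0 <= Num.floor (N%:R * y j))%R.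
    by rewrite floor_ge0 mulr_ge0// ltW.
  lia.
have yij : N%:R * `|y j - y i| < 1.
  have /andP[] := floor_itv (N%:R * y i); have /andP[] := floor_itv (N%:R * y j).
  rewrite bij !intrD => a1 a2 a3 a4.
  rewrite -[X in X * _](gtr0_norm Npos) -normrM mulrBr ltr_norml; lra.
apply: le_lt_trans (int_dist_le _
   (Num.floor (j%:R * x) - Num.floor (i%:R * x))) _.
rewrite -[X in _ < X]mul1r ltr_pdivlMr// mulrC.
rewrite intrB natrB; last exact: ltnW.
suff -> : (j%:R - i%:R) * x - ((Num.floor (j%:R * x))%:~R -
   (Num.floor (i%:R * x))%:~R) = y j - y i by [].
rewrite /y; ring.
Qed.

(** Take delta = ||q beta|| minimal over 0 < q <= N, and let n be the first
    integer with ||n beta|| < delta.  If p and p' are the integers closest to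
    q beta and n beta, the integer q p' - n p equals
    n (q beta - p) - q (n beta - p').  The first term has absolute value
    n delta and the second one is smaller, since q < n and ||n beta|| < delta.
    So the integer is nonzero, and at most 2 n delta in absolute value. *)
Lemma well_spaced_orbit (R : realType) (beta eps : R) :
  irrational beta -> 0 < eps ->
  exists (n : nat) (delta : R), [/\ 0 < delta, delta < eps,
    1 <= 2 * n%:R * delta &
    forall (i : nat) (p : int), (0 < i < n)%N ->
      delta <= `|i%:R * beta - p%:~R| ].
Proof.
move=> irr e0; pose d (i : nat) := int_dist (i%:R * beta).
have d0 i : (0 < i)%N -> 0 < d i.
  move=> i0; rewrite /d; have [p ->] := int_dist_attained (i%:R * beta).
  by rewrite normr_gt0 subr_eq0 irrational_mulrn_neq_int.
have [N N0 Ne] : exists2 N : nat, (0 < N)%N & N%:R^-1 < eps.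
  exists (Num.truncn eps^-1).+1 => //.
  by rewrite invf_plt ?posrE// truncnS_gt.
have [q0 /andP[q00 q0N] dq0] := @dirichlet_approximation R beta N N0.
have q0lt : (q0.-1 < N)%N by lia.
pose o := Ordinal q0lt.
pose q := [arg min_(i < o) d (val i).+1]%O.
have [Q dQ qmin] : exists2 Q : nat, (0 < Q <= N)%N &
   d Q < eps /\ forall i, (0 < i <= N)%N -> d Q <= d i.
  exists (val q).+1; first exact: ltn_ord.
  rewrite /q; case: arg_minP => //= k _ kmin; split.
    apply: le_lt_trans (kmin o isT) _; rewrite /= prednK//.
    exact: lt_trans dq0 Ne.
  move=> i i0; have il : (i.-1 < N)%N by lia.
  by have := kmin (Ordinal il) isT; rewrite /= prednK//; lia.
case: qmin => dQe qmin.
have dQ0 : 0 < d Q by apply: d0; lia.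
(* the next record approximation exists by Dirichlet's theorem *)
have exn : exists n, (0 < n)%N && (d n < d Q).
  have [n n0 dn] := @dirichlet_approximation R beta (Num.truncn (d Q)^-1).+1 isT.
  exists n; apply/andP; split; first lia.
  by apply: lt_trans dn _; rewrite invf_plt ?posrE// truncnS_gt.
case: (ex_minnP exn) => n /andP[n0 dn] nmin.
have Qn : (Q < n)%N.
  apply: contraT; rewrite -leqNgt => nQ.
  by have := qmin n; rewrite leNgt dn; move=> H; have := H ltac:(lia).
exists n, (d Q); split => //; last first.
  move=> i p /andP[i0 ni]; apply: le_trans (int_dist_le _ p).
  rewrite leNgt; apply/negP => h; have := nmin i; rewrite i0 h; lia.
have [p ep] := int_dist_attained (Q%:R * beta).
have [p' ep'] := int_dist_attained (n%:R * beta).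
rewrite /d in dn; rewrite ep' ep in dn; rewrite /d ep.
set D : int := Q%:Z * p' - n%:Z * p.
have DE : D%:~R = n%:R * (Q%:R * beta - p%:~R) - Q%:R * (n%:R * beta - p'%:~R).
  by rewrite /D intrB !intrM; ring.
have Qpos : (0 : R) < Q%:R by rewrite ltr0n; lia.
have npos : (0 : R) < n%:R by rewrite ltr0n.
have Qn' : (Q%:R : R) <= n%:R by rewrite ler_nat ltnW.
have [D0|D0] := eqVneq D 0.
  move: DE; rewrite D0 => /eqP; rewrite eq_sym subr_eq0 => /eqP/(congr1 Num.norm).
  rewrite !normrM (gtr0_norm Qpos) (gtr0_norm npos) => e.
  have : Q%:R * `|n%:R * beta - p'%:~R| < n%:R * `|Q%:R * beta - p%:~R|.
    apply: (@lt_le_trans _ _ (Q%:R * `|Q%:R * beta - p%:~R|)).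
      by rewrite ltr_pM2l.
    by rewrite ler_wpM2r.
  by rewrite e ltxx.
have : 1 <= `|D%:~R : R|.
  by rewrite -intr_norm ler1z; clear - D0; lia.
move=> h; apply: (le_trans h); rewrite DE.
apply: (le_trans (ler_normB _ _)); rewrite !normrM (gtr0_norm Qpos) (gtr0_norm npos).
have : Q%:R * `|n%:R * beta - p'%:~R| <= n%:R * `|Q%:R * beta - p%:~R|.
  by apply: ler_pM => //; exact: ltW.
lra.
Qed.

(** * Extensions of a rotation by integer translations *)

Lemma lebesgue_measure_translation (R : realType) (c : R) (A : set R) :
  measurable A ->
  lebesgue_measure ((fun x => x + c) @^-1` A) = lebesgue_measure A.
Proof.
move=> mA; pose f : R -> measurableTypeR R := fun x => x + c.
have mf : measurable_fun [set: measurableTypeR R] f by apply: measurable_funD.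
transitivity (pushforward (@lebesgue_measure R) f A); first by [].
apply/esym/lebesgue_measure_unique => //= _ [[a b]] _ <-.
rewrite /pushforward (_ : f @^-1` _ = `]a - c, b - c]%classic); last first.
  by apply/seteqP; split => x; rewrite /f /= !in_itv/= ltrBlDr lerBrDr.
rewrite !lebesgue_measure_itv/= !lte_fin ltrD2r; case: ifP => // _.
by rewrite -!EFinB; congr (_%:E); ring.
Qed.

Lemma measurable_translation (R : realType) (c : R) (A : set R) :
  measurable A -> measurable ((fun x => x + c) @^-1` A).
Proof.
move=> mA; have mf : measurable_fun [set: R] (fun x : R => x + c).
  by apply: measurable_funD.
by rewrite -[X in measurable X]setTI; exact: mf.
Qed.

Lemma measurable_Ir (R : realType) (r : nat) : measurable (Ir R r).
Proof. exact: measurable_itv. Qed.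

Lemma lebesgue_Ir (R : realType) (r : nat) :
  lebesgue_measure (Ir R r) = r%:R%:E :> \bar R.
Proof.
rewrite lebesgue_measure_itv/= lte_fin ltr0n; case: posnP => [->//|_].
by rewrite sube0.
Qed.

Lemma lebesgue_fin_num (R : realType) (r : nat) (A : set R) :
  measurable A -> A `<=` Ir R r -> lebesgue_measure A \is a fin_num.
Proof.
move=> mA Ar; rewrite ge0_fin_numE//.
apply: (@le_lt_trans _ _ (lebesgue_measure (Ir R r))).
  by apply: le_measure => //; rewrite inE//; exact: measurable_Ir.
by rewrite lebesgue_Ir ltry.
Qed.

(** All that the ergodic argument needs to know about T.  In the translation
    clause the points x + t with x + t + beta an integer are the only possible
    discontinuities of T: no integer is allowed strictly inside
    x + beta + (0, h), but x + beta itself may be one. *)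
Record rotation_extension (R : realType) (r : nat) (beta : R) (T : R -> R) :
    Prop := RotationExtension {
  rext_stable : forall x, Ir R r x -> Ir R r (T x);
  rext_surj : forall y, Ir R r y -> exists2 x, Ir R r x & T x = y;
  rext_rotation : forall x, Ir R r x ->
    exists p : int, T x = x + beta + p%:~R;
  rext_translation : forall x h, 0 <= x -> x + h <= r%:R ->
    (forall p : int, ~ (x + beta < p%:~R < x + beta + h)) ->
    forall t, 0 <= t < h -> T (x + t) = T x + t;
  rext_measurable : forall A, measurable A ->
    measurable (Ir R r `&` T @^-1` A);
  rext_lebesgue : forall A, measurable A -> A `<=` Ir R r ->
    lebesgue_measure (Ir R r `&` T @^-1` A) = lebesgue_measure A }.

Lemma rext_forward (R : realType) (r : nat) (beta : R) (T : R -> R)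
    (x h : R) : rotation_extension r beta T ->
  0 < h -> 0 <= x -> x + h <= r%:R ->
  (forall p : int, ~ (x + beta < p%:~R < x + beta + h)) ->
  0 <= T x /\ T x + h <= r%:R.
Proof.
move=> eT h0 x0 xh nop.
have inI t : 0 <= t < h -> Ir R r (x + t) by rewrite /Ir/= in_itv/= => ?; lra.
have Tt t : 0 <= t < h -> 0 <= T x + t < r%:R.
  move=> th; rewrite -(rext_translation eT x0 xh nop th).
  by have := rext_stable eT (inI _ th); rewrite /Ir/= in_itv.
split; first by have := Tt 0; rewrite addr0; lra.
rewrite leNgt; apply/negP => H.
have /andP[+ _] := Tt 0 ltac:(lra).
have := Tt (Num.max 0 (r%:R - T x)).
by rewrite /Num.max; case: ifP => ? + ?; lra.
Qed.

(** T^-1 may jump at the integers, and also at T 0, where the preimage may pass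
    from one end of [0, r) to the other.  The second hypothesis on integers
    prevents the translate of [x, x + h) that starts at the preimage of x from
    going beyond r. *)
Lemma rext_backward (R : realType) (r : nat) (beta : R) (T : R -> R)
    (x h : R) : rotation_extension r beta T ->
  0 < h -> 0 <= x -> x + h <= r%:R ->
  (forall p : int, ~ (x < p%:~R < x + h)) ->
  (forall p : int, ~ (x - beta < p%:~R < x - beta + h)) ->
  exists y, [/\ 0 <= y, y + h <= r%:R, T y = x,
    exists p : int, y = x - beta + p%:~R &
    forall p : int, ~ (y + beta < p%:~R < y + beta + h)].
Proof.
move=> eT h0 x0 xh nop nop'.
have Ix : Ir R r x by rewrite /Ir/= in_itv/=; lra.
have [y Iy Ty] := rext_surj eT Ix.
have [p yp] := rext_rotation eT Iy.
move: (Iy); rewrite /Ir/= in_itv/= => /andP[y0 yr].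
exists y; split => //.
- rewrite leNgt; apply/negP => H; apply: (nop' (r%:Z + p)).
  by rewrite intrD -[r%:~R]pmulrn; lra.
- by exists (- p); rewrite intrN; lra.
- by move=> q hq; apply: (nop (q + p)); rewrite intrD; lra.
Qed.

(** E contains its preimage, which has the same measure: the two sets agree up
    to a null set. *)
Lemma lebesgue_translate_invariant (R : realType) (r : nat) (beta : R)
    (T : R -> R) (E : set R) (y h : R) :
  rotation_extension r beta T ->
  measurable E -> E `<=` Ir R r -> Ir R r `&` T @^-1` E `<=` E ->
  0 < h -> 0 <= y -> y + h <= r%:R ->
  (forall t, 0 <= t < h -> T (y + t) = T y + t) ->
  lebesgue_measure (E `&` `[T y, T y + h[) =
  lebesgue_measure (E `&` `[y, y + h[).
Proof.
move=> eT mE EI invE h0 y0 yh Ty.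
pose E' := Ir R r `&` T @^-1` E.
have mE' : measurable E' by exact: (rext_measurable eT mE).
rewrite -(lebesgue_measure_translation (T y - y)); last first.
  by apply: measurableI => //; exact: measurable_itv.
rewrite (_ : _ @^-1` _ = E' `&` `[y, y + h[); last first.
  apply/seteqP; split => x; rewrite /E' /Ir /= !in_itv/=.
    move=> [Ex xh]; have xE : T x = x + (T y - y).
      by rewrite (_ : x = y + (x - y)) ?Ty; lra.
    by rewrite xE; split; [split => //; lra|lra].
  move=> [[Ix Ex] xh]; have xE : T x = x + (T y - y).
    by rewrite (_ : x = y + (x - y)) ?Ty; lra.
  by rewrite xE in Ex; split => //; lra.
have mJ : measurable (`[y, y + h[%classic : set R) by exact: measurable_itv.
have E'0 : lebesgue_measure (E `\` E') = 0%E.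
  rewrite measureD//; last by rewrite ltey_eq (@lebesgue_fin_num R r).
  rewrite setIidr//= /E' (rext_lebesgue eT mE EI) subee//.
  exact: (@lebesgue_fin_num R r).
have mEJ : measurable (E `&` `[y, y + h[) by exact: measurableI.
have J0 : lebesgue_measure ((E `&` `[y, y + h[) `\` E') = 0%E.
  apply: subset_measure0 E'0; first exact: measurableD.
  - exact: measurableD.
  - by move=> x [[]].
have := measureDI lebesgue_measure mEJ mE'; rewrite /= J0 add0e => ->.
by rewrite [E `&` _ `&` E']setIAC (setIidr (invE : E' `<=` E)).
Qed.

(** If an integer lies inside x + i beta + (0, h) and another one inside
    x - j beta + (0, h), with 0 < i <= m and j <= m, then (i + j) beta is within
    h of an integer, although 0 < i + j < n.  So one of the two time directions
    meets no discontinuity.  The translates are disjoint because two of them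
    are shifted by a multiple k beta, 0 < k < n, up to an integer. *)
Lemma disjoint_translates (R : realType) (r : nat) (beta : R) (T : R -> R)
    (E : set R) (n m : nat) (delta x h : R) :
  rotation_extension r beta T ->
  measurable E -> E `<=` Ir R r -> Ir R r `&` T @^-1` E `<=` E ->
  (forall (i : nat) (p : int), (0 < i < n)%N ->
      delta <= `|i%:R * beta - p%:~R|) ->
  (m.*2 < n)%N -> 0 < h -> h <= delta -> 0 <= x -> x + h <= r%:R ->
  exists u : nat -> R,
    (forall i, (i <= m)%N -> [/\ 0 <= u i, u i + h <= r%:R &
      lebesgue_measure (E `&` `[u i, u i + h[) =
      lebesgue_measure (E `&` `[x, x + h[)]) /\
    (forall i j, (i < j <= m)%N -> delta <= `|u i - u j|).
Proof.
move=> eT mE EI invE spaced mn h0 hd x0 xh.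
have spread (u : nat -> R) (gamma : R) : gamma = beta \/ gamma = - beta ->
    (forall i, (i <= m)%N -> exists p : int, u i = x + i%:R * gamma + p%:~R) ->
    forall i j, (i < j <= m)%N -> delta <= `|u i - u j|.
  move=> gE uE i j /andP[ij jm].
  have [p up] := uE i (leq_trans (ltnW ij) jm); have [q uq] := uE j jm.
  have jin : (0 < j - i < n)%N by apply/andP; split; lia.
  have jiE : ((j - i)%:R : R) = j%:R - i%:R by rewrite natrB// ltnW.
  case: gE => gE; rewrite up uq gE.
    apply: le_trans (spaced _ (p - q) jin) _; rewrite jiE intrB distrC.
    by rewrite le_eqVlt; apply/orP; left; apply/eqP; congr (`|_|); ring.
  apply: le_trans (spaced _ (q - p) jin) _; rewrite jiE intrB.
  by rewrite le_eqVlt; apply/orP; left; apply/eqP; congr (`|_|); ring.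
have [fwd|/existsNP[i /not_implyP[im /existsNP[p ip]]]] := pselect
    (forall i, (0 < i <= m)%N -> forall p : int,
       ~ (x + i%:R * beta < p%:~R < x + i%:R * beta + h)).
  exists (fun i => iter i T x).
  have H i : (i <= m)%N -> [/\ 0 <= iter i T x, iter i T x + h <= r%:R,
      exists p : int, iter i T x = x + i%:R * beta + p%:~R &
      lebesgue_measure (E `&` `[iter i T x, iter i T x + h[) =
      lebesgue_measure (E `&` `[x, x + h[)].
    elim: i => [_|i IH im]; first by split => //=; exists 0; lra.
    have [u0 uh [p up] Eu] := IH (ltnW im).
    have nop (q : int) : ~ (iter i T x + beta < q%:~R < iter i T x + beta + h).
      move=> hq; apply: (fwd i.+1 _ (q - p)) => //.
      by rewrite intrB -natr1; rewrite up in hq; lra.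
    have [Tu0 Tuh] := rext_forward eT h0 u0 uh nop.
    split => //.
    - have Iu : Ir R r (iter i T x) by rewrite /Ir/= in_itv/=; lra.
      have [q Tuq] := rext_rotation eT Iu.
      by exists (p + q); rewrite iterS Tuq up intrD -natr1; lra.
    - rewrite iterS (lebesgue_translate_invariant eT)//.
      exact: (rext_translation eT u0 uh nop).
  split; first by move=> i im; have [] := H i im.
  apply: (spread _ beta); first by left.
  by move=> i im; have [] := H i im.
have bwd j : (j <= m)%N -> forall q : int,
    ~ (x - j%:R * beta < q%:~R < x - j%:R * beta + h).
  move=> jm q jq; have /contrapT {}ip := ip.
  have := spaced (i + j)%N (p - q); rewrite natrD intrB => H.
  have {}H : delta <= `|(i%:R + j%:R) * beta - (p%:~R - q%:~R)|.
    by apply: H; move/andP: im => [i0 im]; apply/andP; split; lia.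
  suff : `|(i%:R + j%:R) * beta - (p%:~R - q%:~R)| < h by lra.
  by rewrite ltr_norml; lra.
(* the preimage of y that starts a translate of the interval *)
pose S (y : R) := xget 0 [set z | [/\ 0 <= z, z + h <= r%:R, T z = y,
    exists p : int, z = y - beta + p%:~R &
    forall p : int, ~ (z + beta < p%:~R < z + beta + h)]].
exists (fun i => iter i S x).
have H k : (k <= m)%N -> [/\ 0 <= iter k S x, iter k S x + h <= r%:R,
    exists p : int, iter k S x = x + k%:R * - beta + p%:~R &
    lebesgue_measure (E `&` `[iter k S x, iter k S x + h[) =
    lebesgue_measure (E `&` `[x, x + h[)].
  elim: k => [_|k IH km]; first by split => //=; exists 0; lra.
  have [u0 uh [q uq] Eu] := IH (ltnW km).
  have nop (q' : int) : ~ (iter k S x < q'%:~R < iter k S x + h).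
    move=> hq; apply: (bwd k (ltnW km) (q' - q)).
    by rewrite intrB; rewrite uq in hq; lra.
  have nop' (q' : int) :
      ~ (iter k S x - beta < q'%:~R < iter k S x - beta + h).
    move=> hq; apply: (bwd k.+1 km (q' - q)).
    by rewrite intrB -natr1; rewrite uq in hq; lra.
  have := xgetPex 0 (rext_backward eT h0 u0 uh nop nop').
  rewrite -/(S (iter k S x)) -iterS => -[v0 vh Tv [q' vq'] nopv].
  split => //.
    by exists (q + q'); rewrite vq' uq intrD -natr1; lra.
  rewrite -Eu -[in RHS]Tv; apply/esym/(lebesgue_translate_invariant eT) => //.
  exact: (rext_translation eT v0 vh nopv).
split; first by move=> k km; have [] := H k km.
apply: (spread _ (- beta)); first by right.
by move=> k km; have [] := H k km.
Qed.

(** * Lebesgue measure is ergodic *)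

Lemma compact_separation (R : realType) (K K' : set R) :
  compact K -> compact K' -> K `&` K' = set0 ->
  exists2 d : R, 0 < d & forall x y, K x -> K' y -> d <= `|x - y|.
Proof.
move=> cK cK' KK'.
have [[p Kp]|KK0] := pselect (K `*` K' !=set0); last first.
  by exists 1 => // x y Kx K'y; exfalso; apply: KK0; exists (x, y).
have cf : continuous (fun p : R * R => `|p.1 - p.2|).
  move=> q; apply: cvg_norm; apply: cvgB; [exact: cvg_fst|exact: cvg_snd].
have [q Kq qmin] := @compact_EVT_min _ _ (fun p : R * R => `|p.1 - p.2|)
  (K `*` K') (ex_intro _ p Kp) (compact_setX cK cK')
  (continuous_subspaceT cf).
exists `|q.1 - q.2|; last by move=> x y Kx K'y; apply: (qmin (x, y)); rewrite inE.
rewrite normr_gt0 subr_eq0; apply/eqP => qe.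
move: Kq; rewrite inE => -[Kq1 Kq2].
have : (K `&` K') q.1 by split => //; rewrite qe.
by rewrite KK'.
Qed.

Lemma cumulative_itv (R : realType) (r : nat) (E : set R) (y z : R) :
  measurable E -> E `<=` Ir R r -> y <= z ->
  fine (lebesgue_measure (E `&` `[y, z[)) =
  fine (lebesgue_measure (E `&` `]-oo, z[)) -
  fine (lebesgue_measure (E `&` `]-oo, y[)).
Proof.
move=> mE EI yz.
have fin_meas (i : interval R) :
    lebesgue_measure (E `&` [set` i]) \is a fin_num.
  apply: (@lebesgue_fin_num _ r); last by move=> x [/EI].
  exact: measurableI.
have -> : E `&` `]-oo, z[ = (E `&` `]-oo, y[) `|` (E `&` `[y, z[).
  rewrite -setIUr; congr (_ `&` _); apply/seteqP; split => x /=; rewrite !in_itv/=.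
    by move=> xz; have [xy|yx] := ltP x y; [left|right; apply/andP].
  by case; lra.
rewrite measureU/=.
- by rewrite fineD//; ring.
- exact: measurableI.
- exact: measurableI.
- apply/seteqP; split => x //=; rewrite !in_itv/= => -[[_ ?] [_ ?]]; lra.
Qed.

(** The N intervals [j r / N, (j + 1) r / N) meet E in measure |E| / N on
    average, so one of them does at least as well and one at most as well; the
    measure of E in a sliding window is continuous. *)
Lemma proportional_interval (R : realType) (r N : nat) (E : set R) :
  measurable E -> E `<=` Ir R r -> (0 < N)%N ->
  exists x : R, [/\ 0 <= x, x + r%:R / N%:R <= r%:R &
    lebesgue_measure (E `&` `[x, x + r%:R / N%:R[) =
    (fine (lebesgue_measure E) / N%:R)%:E].
Proof.
move=> mE EI N0; set h := r%:R / N%:R.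
have Npos : (0 : R) < N%:R by rewrite ltr0n.
have h0 : 0 <= h by rewrite divr_ge0.
have Nh : N%:R * h = r%:R by rewrite mulrC mulfVK// gt_eqF.
pose F (y : R) := fine (lebesgue_measure (E `&` `]-oo, y[)).
have fin_meas (i : interval R) :
    lebesgue_measure (E `&` [set` i]) \is a fin_num.
  apply: (@lebesgue_fin_num _ r); last by move=> x [/EI].
  exact: measurableI.
have F_lip y z : y <= z -> 0 <= F z - F y <= z - y.
  move=> yz; rewrite -(cumulative_itv mE EI yz) fine_ge0//=.
  rewrite -lee_fin fineK//.
  apply: (@le_trans _ _ (lebesgue_measure `[y, z[)).
    by apply: le_measure; rewrite ?inE//; exact: measurableI.
  rewrite lebesgue_measure_itv/= lte_fin -EFinB; case: ifP => // _.
  by rewrite lee_fin subr_ge0.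
have F_cont : continuous F.
  move=> y; apply/cvgrPdist_lt => /= e e0.
  apply/nbhs_ballP; exists e => //= t; rewrite /ball/=; apply: le_lt_trans.
  by have [yt|/ltW ty] := leP y t; [have := F_lip _ _ yt|have := F_lip _ _ ty];
    rewrite ler_norml; have := ler_norm (y - t); have := ler_norm (t - y);
    rewrite distrC; lra.
pose g y := F (y + h) - F y.
have g_cont : continuous g.
  move=> y; apply: cvgB; last exact: F_cont.
  apply: (@continuous_comp _ _ _ (fun y => y + h) F); last exact: F_cont.
  by apply: cvgD; [exact: cvg_id|exact: cvg_cst].
set c := fine (lebesgue_measure E) / N%:R.
have F0 : F 0 = 0.
  rewrite /F (_ : _ `&` _ = set0) ?measure0//.
  by apply/seteqP; split => x //= [/EI]; rewrite /Ir/= !in_itv/=; lra.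
have Fr : F r%:R = fine (lebesgue_measure E).
  rewrite /F (_ : _ `&` _ = E)//; apply/setIidl => x /EI.
  by rewrite /Ir/= !in_itv/=; lra.
have sum_g : \sum_(j < N) g (j%:R * h) = \sum_(j < N) c.
  rewrite sumr_const card_ord /c -[RHS]mulr_natr mulfVK ?gt_eqF//.
  transitivity (F (N%:R * h) - F (0%:R * h)); last first.
    by rewrite mul0r F0 subr0 Nh Fr.
  rewrite -(telescope_sumr (fun j => F (j%:R * h)) (leq0n N)) big_mkord.
  by apply: eq_bigr => j _; rewrite /g -[in RHS]natr1 mulrDl mul1r.
have has_ord : has predT (index_enum 'I_N).
  by apply/hasP; exists (Ordinal N0); rewrite ?mem_index_enum.
have [j cj] : exists j : 'I_N, c <= g (j%:R * h).
  apply: contrapT => /forallNP H.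
  have : \sum_(j < N) g (j%:R * h) < \sum_(j < N) c.
    by apply: ltr_sum => // j _; rewrite ltNge; exact/negP.
  by rewrite sum_g ltxx.
have [j' cj'] : exists j : 'I_N, g (j%:R * h) <= c.
  apply: contrapT => /forallNP H.
  have : \sum_(j < N) c < \sum_(j < N) g (j%:R * h).
    by apply: ltr_sum => // i _; rewrite ltNge; exact/negP.
  by rewrite sum_g ltxx.
have jh (i : 'I_N) : 0 <= i%:R * h <= r%:R - h.
  rewrite mulr_ge0//= -Nh lerBrDr -[X in _ + X]mul1r -mulrDl natr1.
  by apply: ler_wpM2r => //; rewrite ler_nat ltn_ord.
have [x xin gx] : exists2 x, 0 <= x <= r%:R - h & g x = c.
  have a1 := jh j; have a2 := jh j'.
  have [jj'|/ltW jj'] := leP (j%:R * h) (j'%:R * h).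
    have [|x] := @IVT _ g _ _ c jj' (continuous_subspaceT g_cont).
      by rewrite ge_min le_max cj cj' orbT.
    by rewrite in_itv/= => xin gx; exists x => //; lra.
  have [|x] := @IVT _ g _ _ c jj' (continuous_subspaceT g_cont).
    by rewrite ge_min le_max cj cj' orbT.
  by rewrite in_itv/= => xin gx; exists x => //; lra.
exists x; split; [lra|lra|].
rewrite -gx /g /F -(cumulative_itv mE EI) ?fineK//; lra.
Qed.

(** Otherwise E and its complement both fill at least the proportion k of every
    interval of the family given by [disjoint_translates], whose total length is
    at least 1 / 8.  Approximate both sets from inside by compact sets K and K',
    up to measure k / 32.  As K and K' are at positive distance, a short interval
    misses one of them, so it meets the error set Z in measure at least k times
    its length; hence k / 8 <= |Z| < k / 16. *)
Lemma invariant_zero_one (R : realType) (r : nat) (beta : R) (T : R -> R)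
    (E : set R) :
  rotation_extension r beta T -> irrational beta -> (0 < r)%N ->
  measurable E -> E `<=` Ir R r -> Ir R r `&` T @^-1` E `<=` E ->
  lebesgue_measure E = 0%E \/ lebesgue_measure (Ir R r `\` E) = 0%E.
Proof.
move=> eT irr r0 mE EI invE.
have mI := @measurable_Ir R r.
have mIE : measurable (Ir R r `\` E) by exact: measurableD.
have IEI : Ir R r `\` E `<=` Ir R r by exact: subDsetl.
have rpos : (0 : R) < r%:R by rewrite ltr0n.
set IE := Ir R r `\` E in mIE IEI *.
have finE := lebesgue_fin_num mE EI; have finIE := lebesgue_fin_num mIE IEI.
set e := fine (lebesgue_measure E); set f := fine (lebesgue_measure IE).
have lE : lebesgue_measure E = e%:E by rewrite fineK.
have lIE : lebesgue_measure IE = f%:E by rewrite fineK.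
have e_ge0 : 0 <= e by rewrite fine_ge0.
have f_ge0 : 0 <= f by rewrite fine_ge0.
rewrite lE lIE; apply: contrapT => /not_orP[eN0 fN0].
have {eN0}e0 : 0 < e.
  by rewrite lt_neqAle e_ge0 andbT eq_sym; apply/eqP => e0; rewrite e0 in eN0.
have {fN0}f0 : 0 < f.
  by rewrite lt_neqAle f_ge0 andbT eq_sym; apply/eqP => f0; rewrite f0 in fN0.
have ef : e + f = r%:R.
  apply/EFin_inj; rewrite EFinD -lE -lIE -(lebesgue_Ir R r) addeC.
  have := measureDI lebesgue_measure mI mE => /= ->.
  by rewrite (setIidr EI).
pose k := Num.min e f / r%:R.
have k0 : 0 < k by rewrite divr_gt0// lt_min e0.
have ke : k <= e / r%:R by rewrite ler_pM2r ?invr_gt0// ge_min lexx.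
have kf : k <= f / r%:R by rewrite ler_pM2r ?invr_gt0// ge_min lexx orbT.
have k32 : 0 < k / 32 by rewrite divr_gt0.
have [K [cK KE lK]] := lebesgue_regularity_inner mE
  (ltac:(by rewrite lE ltry) : (lebesgue_measure E < +oo)%E) k32.
have [K' [cK' KE' lK']] := lebesgue_regularity_inner mIE
  (ltac:(by rewrite lIE ltry) : (lebesgue_measure IE < +oo)%E) k32.
have [d d0 dKK'] : exists2 d : R, 0 < d &
    forall x y, K x -> K' y -> d <= `|x - y|.
  apply: compact_separation => //; apply/seteqP; split => // x [/KE Ex].
  by case/KE' => _; apply.
have [n [delta [delta0 delta_lt ndelta spaced]]] :=
  well_spaced_orbit irr (ltac:(by rewrite lt_min d0 ltr01) : 0 < Num.min d 1).
have {delta_lt} [deltad delta1] : delta < d /\ delta < 1.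
  by move: delta_lt; rewrite lt_min => /andP[].
(* the common length of the intervals is the fraction of [0, r) closest below
   delta, so that it lies between delta / 2 and delta *)
have [N N0 [hlt hge]] : exists2 N : nat, (0 < N)%N &
    r%:R / N%:R < delta /\ delta / 2 <= r%:R / N%:R.
  exists (Num.truncn (r%:R / delta)).+1 => //.
  have rd0 : 0 <= r%:R / delta by rewrite divr_ge0// ltW.
  have := truncn_itv rd0 => /andP[]; set N := _.+1 => Nle Nlt.
  have Npos : (0 : R) < N%:R by rewrite ltr0n.
  have NE : (Num.truncn (r%:R / delta))%:R = N%:R - 1 :> R.
    by rewrite /N -natr1 addrK.
  have r1 : (1 : R) <= r%:R by rewrite ler1n.
  split; first by rewrite ltr_pdivrMr// mulrC -ltr_pdivrMr.
  rewrite ler_pdivlMr//; rewrite NE ler_pdivlMr// in Nle.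
  by lra.
set h := r%:R / N%:R in hlt hge *.
have h0 : 0 < h by rewrite divr_gt0// ltr0n.
have [x [x0 xh Exh]] := proportional_interval mE EI N0.
rewrite -/h in xh Exh.
have eN : e / N%:R = e / r%:R * h by rewrite /h mulrA mulfVK// gt_eqF.
rewrite -/e eN in Exh.
have n0 : (0 < n)%N.
  by rewrite lt0n; apply/eqP => n0; move: ndelta; rewrite n0 mulr0 mul0r ler10.
have [m mn nm] : exists2 m, (m.*2 < n)%N & (n <= m.+1.*2)%N.
  by clear - n0; exists n.-1./2; lia.
have [u [uin usep]] := disjoint_translates eT mE EI invE spaced mn h0 (ltW hlt)
  x0 xh.
pose L i := `[u i, u i + h[%classic : set R.
have mL i : measurable (L i) by exact: measurable_itv.
pose Z := (E `\` K) `|` (IE `\` K').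
have mK : measurable K by exact: compact_measurable.
have mK' : measurable K' by exact: compact_measurable.
have mEK : measurable (E `\` K) by exact: measurableD.
have mIEK : measurable (IE `\` K') by exact: measurableD.
have mZ : measurable Z by exact: measurableU.
have lZ : (lebesgue_measure Z < (k / 16)%:E)%E.
  have /= := measureU2 lebesgue_measure mEK mIEK; move/le_lt_trans; apply.
  have -> : k / 16 = k / 32 + k / 32 by field.
  by rewrite EFinD lteD.
have mLZ i : measurable (L i `&` Z).
  by apply: measurableI; [exact: mL|exact: mZ].
have lLZ i : (i <= m)%N -> ((k * h)%:E <= lebesgue_measure (L i `&` Z))%E.
  move=> im; have [ui0 uih lEL] := uin i im.
  have LI : L i `<=` Ir R r by move=> y; rewrite /L /Ir/= !in_itv/=; lra.
  have lL : lebesgue_measure (L i) = h%:E.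
    rewrite /L lebesgue_measure_itv/= lte_fin ltrDl h0 -EFinB.
    by congr (_%:E); ring.
  have [[y [Ly Ky]]|LK0] := pselect (L i `&` K !=set0); last first.
    apply: (@le_trans _ _ (lebesgue_measure (E `&` L i))).
      by rewrite lEL Exh lee_fin ler_pM2r.
    apply: le_measure; rewrite ?inE; [|exact: mLZ|].
      by apply: measurableI => //; exact: mL.
    by move=> y [Ey Ly]; split => //; left; split => // Ky; apply: LK0; exists y.
  apply: (@le_trans _ _ (lebesgue_measure (L i `\` E))).
    have := @measureD _ _ _ lebesgue_measure _ _ (mL i) mE.
    rewrite /= lL ltry => /(_ isT) ->.
    rewrite setIC lEL Exh -EFinB lee_fin.
    have -> : h - e / r%:R * h = f / r%:R * h.
      have -> : f = r%:R - e by rewrite -ef; ring.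
      by rewrite mulrBl divff ?gt_eqF//; ring.
    by rewrite ler_pM2r.
  apply: le_measure; rewrite ?inE; [|exact: mLZ|].
    by apply: measurableD => //; exact: mL.
  move=> z [Lz Ez]; split => //; right; split; first by split => //; exact: LI.
  move=> K'z; have := dKK' _ _ Ky K'z; apply/negP; rewrite -ltNge.
  move: Ly Lz; rewrite /L/= !in_itv/= => Ly Lz.
  by rewrite ltr_norml; lra.
have tLZ : trivIset [set: 'I_m.+1] (fun i : 'I_m.+1 => L i `&` Z).
  apply/trivIsetP => i j _ _ ij; apply/seteqP; split => // z [[Liz _] [Ljz _]].
  wlog lij : i j ij Liz Ljz / (i < j)%N.
    move=> H; have : (i < j)%N || (j < i)%N by rewrite -neq_ltn.
    by case/orP => l; [exact: (H i j)|apply: (H j i) => //; rewrite eq_sym].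
  have := usep i j; rewrite lij -ltnS ltn_ord => /(_ isT).
  apply/negP; rewrite -ltNge; move: Liz Ljz; rewrite /L/= !in_itv/= => ? ?.
  by rewrite ltr_norml; lra.
have : ((m.+1%:R * (k * h))%:E <= lebesgue_measure Z)%E.
  apply: (@le_trans _ _ (\sum_(i < m.+1) lebesgue_measure (L i `&` Z))%E).
    rewrite mulr_natl -[X in (_ *+ X)%:E](card_ord m.+1) -sumr_const -sumEFin.
    by apply: lee_sum => i _; apply: lLZ; rewrite -ltnS.
  have := @measure_bigsetU_ord _ _ _ lebesgue_measure m.+1 predT
    (fun i : 'I_m.+1 => L i `&` Z) (fun i => mLZ i) tLZ.
  move=> /= <-; apply: le_measure; rewrite ?inE//.
    by apply: bigsetU_measurable => i _; exact: mLZ.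
  apply: (big_ind (fun A => A `<=` Z)); first exact: sub0set.
    by move=> A B AZ BZ; rewrite subUset.
  by move=> i _; exact: subIsetr.
apply/negP; rewrite -ltNge; apply: (lt_le_trans lZ); rewrite lee_fin.
have nm' : (n%:R : R) <= m.+1%:R * 2 by rewrite -natrM ler_nat muln2.
have : n%:R * delta <= (m.+1%:R * 2) * (2 * h).
  by apply: ler_pM => //; [exact: ltW|lra].
rewrite (_ : m.+1%:R * (k * h) = (m.+1%:R * h) * k); last by ring.
rewrite (_ : k / 16 = 16^-1 * k); last by ring.
by rewrite ler_pM2r//; lra.
Qed.

(** * Invariant measures are absolutely continuous *)

(** The preimages of S under T^i, 0 <= i < n, all have the measure of S.  They
    are disjoint, since a point of two of them would make the multiple of beta by
    some 0 < k < n closer than delta to an integer. *)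
Lemma small_set_measure (R : realType) (r : nat) (beta : R) (T : R -> R)
    (nu : probability (measurableTypeR R) R) (n : nat) (delta : R)
    (S : set R) :
  rotation_extension r beta T -> invariant_measure r T nu ->
  (forall (i : nat) (p : int), (0 < i < n)%N ->
      delta <= `|i%:R * beta - p%:~R|) ->
  measurable S -> S `<=` Ir R r ->
  (forall x y, S x -> S y -> `|x - y| < delta) ->
  n%:R * fine (nu S) <= 1.
Proof.
move=> eT inv spaced mS SI diamS.
pose B i := iter i (fun A => Ir R r `&` T @^-1` A) S.
have BE i : [/\ measurable (B i), B i `<=` Ir R r, nu (B i) = nu S &
    forall z, B i z -> exists p : int, S (z + i%:R * beta + p%:~R)].
  elim: i => [|i [mB BI nuB Bz]].
    by split => // z Sz; exists 0; rewrite mul0r !addr0.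
  split.
  - exact: (rext_measurable eT mB).
  - exact: subIsetl.
  - by rewrite /B iterS inv.
  - move=> z [Iz /Bz [p]]; have [q ->] := rext_rotation eT Iz.
    exists (q + p); rewrite intrD -natr1.
    rewrite (_ : z + _ + _ = z + beta + q%:~R + i%:R * beta + p%:~R)//; ring.
have tB : trivIset [set: 'I_n] (fun i : 'I_n => B i).
  apply/trivIsetP => i j _ _ ij; apply/seteqP; split => // z [Biz Bjz].
  wlog lij : i j ij Biz Bjz / (i < j)%N.
    move=> H; have : (i < j)%N || (j < i)%N by rewrite -neq_ltn.
    by case/orP => l; [exact: (H i j)|apply: (H j i) => //; rewrite eq_sym].
  have [_ _ _ /(_ _ Biz) [p Sp]] := BE i.
  have [_ _ _ /(_ _ Bjz) [q Sq]] := BE j.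
  have jin : (0 < j - i < n)%N by have := ltn_ord j; lia.
  have := spaced _ (p - q) jin; apply/negP; rewrite -ltNge.
  rewrite natrB 1?ltnW// intrB; have := diamS _ _ Sq Sp.
  set a := (X in `|X| < _ -> _); set b := (X in _ -> `|X| < _).
  by rewrite (_ : a = b)// /a /b; ring.
have nuS : nu S = (fine (nu S))%:E by rewrite fineK// fin_num_measure.
have mB (i : 'I_n) : measurable (B i) by have [] := BE i.
have H := @measure_bigsetU_ord _ _ _ nu n predT (fun i : 'I_n => B i) mB tB.
rewrite -lee_fin mulr_natl.
rewrite -[X in (_ *+ X)%:E](card_ord n) -sumr_const -sumEFin.
rewrite (eq_bigr (fun i : 'I_n => nu (B i))); last first.
  by move=> i _; rewrite -nuS; have [_ _ ->] := BE i.
rewrite -H; apply: probability_le1.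
by apply: bigsetU_measurable => i _; exact: mB.
Qed.

(** Cover the interval by about (b - a) / delta intervals of length delta, each
    of mass at most 1 / n <= 2 delta, and let delta tend to 0. *)
Lemma invariant_itv_le (R : realType) (r : nat) (beta : R) (T : R -> R)
    (nu : probability (measurableTypeR R) R) (a b : R) :
  irrational beta -> rotation_extension r beta T -> invariant_measure r T nu ->
  a <= b -> fine (nu (Ir R r `&` `]a, b])) <= 2 * (b - a).
Proof.
move=> irr eT inv ab; have mI := @measurable_Ir R r.
have fin_meas (i : interval R) : nu (Ir R r `&` [set` i]) \is a fin_num.
  by apply: fin_num_measure; exact: measurableI.
apply/ler_addgt0Pr => eps eps0.
have [n [delta [delta0 delta_lt ndelta spaced]]] :=
  well_spaced_orbit irr (ltac:(lra) : 0 < eps / 2).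
have n0 : (0 : R) < n%:R.
  rewrite ltr0n lt0n; apply/eqP => n0.
  by move: ndelta; rewrite n0 mulr0 mul0r ler10.
have step N c : c <= b -> b - c <= N%:R * delta ->
    n%:R * fine (nu (Ir R r `&` `]c, b])) <= N%:R.
  elim: N c => [|N IH] c cb.
    rewrite mul0r => cb'; have -> : c = b by lra.
    by rewrite set_itv_ge ?bnd_simp ?ltxx// setI0 measure0 mulr0.
  rewrite -natr1 mulrDl mul1r => bcN.
  pose c' := Num.min b (c + delta).
  have cc' : c <= c' by rewrite le_min cb lerDl ltW.
  have c'b : c' <= b by rewrite ge_min lexx.
  have bc' : b - c' <= N%:R * delta.
    rewrite /c' /Num.min; case: ifP => _; last by lra.
    by rewrite subrr mulr_ge0// ltW.
  have -> : Ir R r `&` `]c, b] =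
      (Ir R r `&` `]c, c']) `|` (Ir R r `&` `]c', b]).
    rewrite -setIUr; congr (_ `&` _); apply/seteqP; split => x /=.
      by rewrite !in_itv/= => /andP[-> ->]; have [_|_] := leP x c'; [left|right].
    by rewrite !in_itv/= => -[]; lra.
  rewrite measureU/=; last first.
  - by apply/seteqP; split => x //=; rewrite !in_itv/= => -[[_ ?] [_ ?]]; lra.
  - exact: measurableI.
  - exact: measurableI.
  rewrite fineD// mulrDr addrC; apply: lerD; first exact: IH.
  apply: (small_set_measure eT inv spaced); [exact: measurableI| |].
    exact: subIsetl.
  move=> x y [_ +] [_ +]; rewrite /= !in_itv/= => /andP[cx xc'] /andP[cy yc'].
  have c'd : c' <= c + delta by rewrite ge_min lexx orbT.
  by rewrite ltr_norml; lra.
have q0 : 0 <= (b - a) / delta by rewrite divr_ge0 ?subr_ge0// ltW.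
have /andP[Nle Nlt] := truncn_itv q0.
have := step (Num.truncn ((b - a) / delta)).+1 a ab.
rewrite -ler_pdivrMr//; move=> /(_ (ltW Nlt)).
set v := fine _ => nv.
have {}nv : n%:R * v <= (b - a) / delta + 1.
  by apply: le_trans nv _; rewrite -natr1 lerD2r.
have v0 : 0 <= v by rewrite fine_ge0.
have vd : v <= 2 * delta * (n%:R * v).
  by rewrite mulrCA mulrA -[X in X <= _]mul1r ler_wpM2r//; lra.
apply: (le_trans vd).
apply: (@le_trans _ _ (2 * delta * ((b - a) / delta + 1))).
  by rewrite ler_pM2l// mulr_gt0.
rewrite mulrDr mulr1 mulrCA -mulrA mulrCA divff ?gt_eqF// mulr1 ?mulr1; lra.
Qed.

Lemma invariant_abs_continuous (R : realType) (r : nat) (beta : R) (T : R -> R)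
    (nu : probability (measurableTypeR R) R) (A : set R) :
  irrational beta -> rotation_extension r beta T -> invariant_measure r T nu ->
  measurable A -> A `<=` Ir R r -> lebesgue_measure A = 0%E -> nu A = 0%E.
Proof.
move=> irr eT inv mA AI A0; have mI := @measurable_Ir R r.
apply/eqP; rewrite -measure_le0; apply/lee_addgt0Pr => eps eps0; rewrite add0e.
have /ereal_inf_lt[z [/= F [mF AF] Fz] zeps] :
    (lebesgue_measure A < (eps / 2)%:E)%E.
  by rewrite A0 lte_fin divr_gt0.
apply: (@le_trans _ _ (\sum_(k <oo) nu (Ir R r `&` F k))%E).
  apply: measure_sigma_subadditive => //.
    move=> k; apply: measurableI => //; apply: sub_sigma_algebra; exact: mF.
  by rewrite -setI_bigcupr => x Ax; split; [exact: AI|exact: AF].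
apply: (@le_trans _ _ (\sum_(k <oo) 2%:E * wlength idfun (F k))%E).
  apply: lee_nneseries => // k _.
  have /ocitvP[-> | [[a b] /= ab ->]] := mF k.
    by rewrite setI0 measure0 wlength0 mule0.
  rewrite wlength_itv/= lte_fin ab -EFinB -EFinM.
  rewrite -[leLHS]fineK; last by apply: fin_num_measure; exact: measurableI.
  by rewrite lee_fin; apply: (invariant_itv_le irr eT inv); exact: ltW.
rewrite nneseriesZl; last by move=> k _; exact: wlength_ge0.
rewrite Fz; apply: (@le_trans _ _ (2%:E * (eps / 2)%:E)%E).
  by apply: lee_wpmul2l => //; exact: ltW.
by rewrite -EFinM mulrC mulfVK.
Qed.

(** * Unique ergodicity *)

Definition excess (R : realType) (r : nat) (nu : set R -> \bar R) (A : set R) :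
    R :=
  fine (nu A) - r%:R^-1 * fine (lebesgue_measure A).

(** The positive part of a Hahn decomposition. *)
Lemma excess_max (R : realType) (r : nat)
    (nu : probability (measurableTypeR R) R) :
  exists P : set R, [/\ measurable P, P `<=` Ir R r &
    forall A, measurable A -> A `<=` Ir R r -> excess r nu A <= excess r nu P].
Proof.
have mI : (@measurable _ (measurableTypeR R)) (Ir R r) := @measurable_Ir R r.
pose mu : {measure set (measurableTypeR R) -> \bar R} := @lebesgue_measure R.
have finI : (mu (Ir R r) < +oo)%E by rewrite /mu/= lebesgue_Ir ltry.
pose phi : {charge set (measurableTypeR R) -> \bar R} :=
  cadd (charge_of_finite_measure nu)
    (cscale (- r%:R^-1) (charge_of_finite_measure (mfrestr mI finI))).
have phiE A : measurable A -> A `<=` Ir R r -> phi A = (excess r nu A)%:E.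
  move=> mA AI; rewrite /phi /= /cadd /cscale /= /charge_of_finite_measure.
  rewrite /cscale /= /mfrestr /mrestr /mu /= (setIidl AI) /excess EFinB EFinM.
  rewrite fineK ?fin_num_measure// fineK; last exact: (@lebesgue_fin_num _ r).
  by rewrite EFinN mulNe.
have [P [N [[mP posP] [mN negN] PN PN0]]] := Hahn_decomposition phi.
have mPI : measurable (P `&` Ir R r) by exact: measurableI.
exists (P `&` Ir R r); split => //.
move=> A mA AI; rewrite -lee_fin -!phiE//.
have -> : A = (A `&` P) `|` (A `&` N) by rewrite -setIUr PN setIT.
have -> : P `&` Ir R r = (A `&` P) `|` ((P `&` Ir R r) `\` A).
  apply/seteqP; split => x.
    by move=> [Px Ix]; have [Ax|nAx] := pselect (A x); [left|right].
  by case => [[Ax Px]|[]//]; split => //; exact: AI.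
rewrite !chargeU.
- apply: leeD => //; apply: (@le_trans _ _ 0%E).
    by apply: negN; [exact: measurableI|exact: subIsetr].
  by apply: posP; [exact: measurableD|move=> x [[]]].
- exact: measurableI.
- exact: measurableD.
- by apply/seteqP; split => x // [[Ax _] [_]].
- exact: measurableI.
- exact: measurableI.
- by rewrite setIACA PN0 setI0.
Qed.

Lemma excess_setU (R : realType) (r : nat)
    (nu : probability (measurableTypeR R) R) (A B : set R) :
  measurable A -> measurable B -> A `<=` Ir R r -> B `<=` Ir R r ->
  excess r nu (A `|` B) + excess r nu (A `&` B) = excess r nu A + excess r nu B.
Proof.
move=> mA mB AI BI.
have fl C : measurable C -> C `<=` Ir R r -> lebesgue_measure C \is a fin_num.
  exact: lebesgue_fin_num.
have mAB : measurable (A `&` B) by exact: measurableI.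
have fAB : lebesgue_measure (A `&` B) \is a fin_num by apply: fl => // x [/AI].
have fA := fl _ mA AI; have fB := fl _ mB BI.
have nuU := @measureUfinr _ _ _ nu _ _ mA mB.
have lU : lebesgue_measure (A `|` B) =
    (lebesgue_measure A + lebesgue_measure B - lebesgue_measure (A `&` B))%E.
  by apply: (@measureUfinr _ _ _ lebesgue_measure) => //; rewrite ltey_eq fB.
rewrite /excess nuU ?ltey_eq ?fin_num_measure//.
move: fA fB fAB lU; move: (lebesgue_measure A) (lebesgue_measure B)
  (lebesgue_measure (A `&` B)) (lebesgue_measure (A `|` B)) => a b c u fA fB fC ->.
rewrite !fineB ?fin_numD ?fA ?fB ?fin_num_measure//.
by rewrite !fineD ?fin_num_measure//; ring.
Qed.

(** Let P have maximal excess.  By [excess_setU], the union of two sets of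
    maximal excess has maximal excess too, since the excess of their
    intersection is at most the maximum.  So the union F of all T^-n P has
    maximal excess; it contains its preimage, and the zero-one law applies to
    it.  The excess vanishes on null and on conull sets, so it is nonpositive on
    every set; applied to complements, this gives equality. *)
Lemma rotation_extension_uniquely_ergodic (R : realType) (r : nat) (beta : R)
    (T : R -> R) :
  rotation_extension r beta T -> irrational beta -> (0 < r)%N ->
  uniquely_ergodic r T.
Proof.
move=> eT irr r0; have mI := @measurable_Ir R r.
have rpos : (0 : R) < r%:R by rewrite ltr0n.
have lebinv := rext_lebesgue eT.
split; first by move=> A mA AI; rewrite /normalized_lebesgue lebinv.
move=> nu nuI inv.
have nuC A : measurable A -> A `<=` Ir R r ->
    fine (nu (Ir R r `\` A)) = 1 - fine (nu A).
  move=> mA AI; have /= := measureDI nu mI mA; rewrite nuI (setIidr AI) => e.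
  have : fine 1%E = fine (nu (Ir R r `\` A) + nu A) by rewrite e.
  by rewrite fineD ?fin_num_measure//; [move=> /= ->; ring|exact: measurableD].
have lC A : measurable A -> A `<=` Ir R r ->
    fine (lebesgue_measure (Ir R r `\` A)) =
    r%:R - fine (lebesgue_measure A).
  move=> mA AI; have := measureDI lebesgue_measure mI mA.
  rewrite /= lebesgue_Ir (setIidr AI) => e.
  have : fine r%:R%:E = fine (lebesgue_measure (Ir R r `\` A) +
    lebesgue_measure A)%E by rewrite e.
  rewrite fineD ?(@lebesgue_fin_num _ r)//; last exact: measurableD.
  by move=> /= ->; ring.
suff exc_le0 A : measurable A -> A `<=` Ir R r -> excess r nu A <= 0.
  move=> A mA AI; rewrite /normalized_lebesgue.
  rewrite -[LHS]fineK ?fin_num_measure// -[lebesgue_measure A]fineK; last first.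
    exact: (@lebesgue_fin_num _ r).
  rewrite -EFinM; congr (_%:E); apply/eqP; rewrite eq_le; apply/andP; split.
    by rewrite -subr_le0; exact: exc_le0.
  have := exc_le0 (Ir R r `\` A) (measurableD mI mA) (@subDsetl _ _ _).
  by rewrite /excess nuC// lC// mulrBr mulVf ?gt_eqF//; lra.
have [P [mP PI maxP]] := excess_max r nu.
pose E n := iter n (fun B => B `|` (Ir R r `&` T @^-1` B)) P.
have mE n : measurable (E n).
  by elim: n => // k IH; apply: measurableU => //; exact: (rext_measurable eT).
have EI n : E n `<=` Ir R r.
  by elim: n => // k IH x [/IH //|[]].
have excE n : excess r nu (E n) = excess r nu P.
  elim: n => // k IH; apply/eqP; rewrite eq_le (maxP _ (mE k.+1) (EI k.+1)) /=.
  have mTE : measurable (Ir R r `&` T @^-1` E k) by exact: (rext_measurable eT).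
  have := excess_setU nu (mE k) mTE (EI k) (@subIsetl _ _ _).
  rewrite -/(E k.+1).
  have -> : excess r nu (Ir R r `&` T @^-1` E k) = excess r nu P.
    by rewrite -IH /excess inv// lebinv.
  rewrite IH => e.
  have := maxP (E k `&` (Ir R r `&` T @^-1` E k)) (measurableI _ _ (mE k) mTE).
  have sI : E k `&` (Ir R r `&` T @^-1` E k) `<=` Ir R r by move=> x [/EI].
  by move=> /(_ sI); lra.
pose F := \bigcup_n E n.
have mF : measurable F by exact: bigcup_measurable.
have FI : F `<=` Ir R r by move=> x [n _ /EI].
have Fdec : Ir R r `&` T @^-1` F `<=` F.
  by move=> x [Ix [n _ Ex]]; exists n.+1 => //; right.
have ndE : nondecreasing_seq E.
  by apply/nondecreasing_seqP => n; apply/subsetPset => x Ex; left.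
have nuF : fine (nu (E n)) @[n --> \oo] --> fine (nu F).
  apply: fine_cvg; rewrite fineK ?fin_num_measure//.
  exact: nondecreasing_cvg_mu.
have lF : fine (lebesgue_measure (E n)) @[n --> \oo] -->
    fine (lebesgue_measure F).
  apply: fine_cvg; rewrite fineK ?(@lebesgue_fin_num _ r)//.
  exact: (@nondecreasing_cvg_mu _ _ _ lebesgue_measure).
have excF : excess r nu F = excess r nu P.
  have H : excess r nu (E n) @[n --> \oo] --> excess r nu F.
    by apply: cvgB => //; apply: cvgM => //; exact: cvg_cst.
  have H' : excess r nu (E n) @[n --> \oo] --> excess r nu P.
    rewrite (_ : (fun n => excess r nu (E n)) = (fun=> excess r nu P)).
      exact: cvg_cst.
    by apply/funext => n; exact: excE.
  exact: (cvg_unique _ H H').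
move=> mA AI; apply: le_trans (maxP _ mA AI) _; rewrite -excF /excess.
have [lF0|lF0] := invariant_zero_one eT irr r0 mF FI Fdec.
  rewrite (invariant_abs_continuous irr eT inv mF FI lF0) lF0 /=.
  by rewrite mulr0 subr0.
have mIF : measurable (Ir R r `\` F) by exact: measurableD.
have IFI : Ir R r `\` F `<=` Ir R r by exact: subDsetl.
have := nuC F mF FI.
rewrite (invariant_abs_continuous irr eT inv mIF IFI lF0) /= => e1.
have := lC F mF FI; rewrite lF0 /= => e2.
have -> : fine (nu F) = 1 by lra.
have -> : fine (lebesgue_measure F) = r%:R by lra.
by rewrite mulVf ?gt_eqF// subrr.
Qed.

(** * Interval exchanges preserve Lebesgue measure *)

Section interval_exchange_theory.
Context (R : realType) (r m : nat) (T : R -> R) (a d : nat -> R).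
Context (iet : interval_exchange r m T a d).

Lemma cut_points_le i j : (i <= j <= m)%N -> a i <= a j.
Proof.
have [_ _ a_lt _ _] := iet; move=> /andP[ij jm].
elim: j ij jm => [|j IH]; first by rewrite leqn0 => /eqP ->.
rewrite leq_eqVlt => /predU1P[-> //|]; rewrite ltnS => ij jm.
by apply: le_trans (IH ij (ltnW jm)) _; exact/ltW/a_lt.
Qed.

Lemma piece_sub i : (i < m)%N -> `[a i, a i.+1[ `<=` Ir R r.
Proof.
move=> im x; have [_ [a0 am] _ _ _] := iet.
have h0 : a 0 <= a i by apply: cut_points_le; rewrite leq0n ltnW.
have hm : a i.+1 <= a m by apply: cut_points_le; rewrite im leqnn.
by rewrite /Ir/= !in_itv/= -am -a0; lra.
Qed.

Lemma piece_cover x : Ir R r x -> exists2 i, (i < m)%N & x \in `[a i, a i.+1[.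
Proof.
have [_ [a0 am] _ _ _] := iet; rewrite /Ir/= in_itv/= -am -a0 => /andP[].
elim: m => [|k IH] ax xa; first by have := le_lt_trans ax xa; rewrite ltxx.
have [xk|kx] := ltP x (a k).
  by have [i ik ix] := IH ax xk; exists i => //; exact: ltnW.
by exists k => //; rewrite in_itv/= kx.
Qed.

Lemma piece_disjoint i j x : (i < m)%N -> (j < m)%N ->
  x \in `[a i, a i.+1[ -> x \in `[a j, a j.+1[ -> i = j.
Proof.
wlog ij : i j / (i <= j)%N.
  move=> H im jm xi xj; case: (leqP i j) => [ij|/ltnW ji]; first exact: H.
  by apply/esym; exact: H.
move=> im jm; rewrite !in_itv/= => xi xj; apply/eqP.
move: ij; rewrite leq_eqVlt => /orP[//|ij].
have : a i.+1 <= a j by apply: cut_points_le; rewrite ij ltnW.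
by lra.
Qed.

Let preimage_piece A i : (i < m)%N ->
  `[a i, a i.+1[ `&` T @^-1` A =
  (fun x => x + d i) @^-1` (A `&` `[a i + d i, a i.+1 + d i[).
Proof.
move=> im; have [_ _ _ Td _] := iet; apply/seteqP; split => x /=.
  move=> [xi]; rewrite (Td i im x xi); split => //.
  by move: xi; rewrite !in_itv/= !lerD2r !ltrD2r.
move=> [Ax xi]; have {}xi : x \in `[a i, a i.+1[.
  by move: xi; rewrite !in_itv/= !lerD2r !ltrD2r.
by rewrite (Td i im x xi).
Qed.

Let preimage_cover A : Ir R r `&` T @^-1` A =
  \big[setU/set0]_(i < m) (`[a i, a i.+1[ `&` T @^-1` A).
Proof.
rewrite -(bigcup_mkord m (fun i => `[a i, a i.+1[ `&` T @^-1` A)).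
apply/seteqP; split => x.
  by move=> [/piece_cover[i im xi] Ax]; exists i.
by move=> [i /= im [xi Ax]]; split => //; exact: piece_sub im _ xi.
Qed.

Let measurable_piece A i : measurable A -> (i < m)%N ->
  measurable (`[a i, a i.+1[ `&` T @^-1` A).
Proof.
move=> mA im; rewrite preimage_piece//; apply: measurable_translation.
by apply: measurableI => //; exact: measurable_itv.
Qed.

Lemma interval_exchange_measurable A : measurable A ->
  measurable (Ir R r `&` T @^-1` A).
Proof.
move=> mA; rewrite preimage_cover; apply: bigsetU_measurable => i _.
exact: measurable_piece.
Qed.

(** The image of the piece i is its translate by d i; as T is a bijection these
    translates partition [0, r), and Lebesgue measure is translation
    invariant. *)
Lemma interval_exchange_lebesgue A : measurable A -> A `<=` Ir R r ->
  lebesgue_measure (Ir R r `&` T @^-1` A) = lebesgue_measure A.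
Proof.
move=> mA AI; have [[Tfun Tinj Tsurj] _ _ Td _] := iet.
pose J i := A `&` `[a i + d i, a i.+1 + d i[.
have mJ (i : 'I_m) : measurable (J i).
  by apply: measurableI => //; exact: measurable_itv.
have JT i x : (i < m)%N -> J i x -> exists2 y, y \in `[a i, a i.+1[ & T y = x.
  move=> im [_]; rewrite /= in_itv/= => xi.
  have yi : x - d i \in `[a i, a i.+1[ by rewrite in_itv/=; lra.
  by exists (x - d i) => //; rewrite (Td i im _ yi) subrK.
have tJ : trivIset [set: 'I_m] (fun i : 'I_m => J i).
  apply/trivIsetP => i j _ _ ij; apply/seteqP; split => // x [Jix Jjx].
  have [y yi Ty] := JT _ _ (ltn_ord i) Jix.
  have [z zj Tz] := JT _ _ (ltn_ord j) Jjx.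
  have Iy := piece_sub (ltn_ord i) yi; have Iz := piece_sub (ltn_ord j) zj.
  have yz : y = z by apply: Tinj; rewrite ?inE// Ty Tz.
  move: zj; rewrite -yz => yj.
  have /val_inj e := piece_disjoint (ltn_ord i) (ltn_ord j) yi yj.
  by move: ij; rewrite e eqxx.
have tP : trivIset [set: 'I_m] (fun i : 'I_m => `[a i, a i.+1[ `&` T @^-1` A).
  apply/trivIsetP => i j _ _ ij; apply/seteqP; split => // x [[xi _] [xj _]].
  have /val_inj e := piece_disjoint (ltn_ord i) (ltn_ord j) xi xj.
  by move: ij; rewrite e eqxx.
have mP (i : 'I_m) : measurable (`[a i, a i.+1[ `&` T @^-1` A).
  exact: measurable_piece.
have AE : A = \big[setU/set0]_(i < m) J i.
  rewrite -(bigcup_mkord m J); apply/seteqP; split => x; last by move=> [i _ []].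
  move=> Ax; have [y Iy Ty] := Tsurj _ (AI _ Ax).
  have [i im yi] := piece_cover Iy; exists i => //; split => //.
  by rewrite -Ty (Td i im y yi)/= in_itv/= lerD2r ltrD2r; move: yi; rewrite in_itv.
rewrite [in RHS]AE preimage_cover.
have /= -> := @measure_bigsetU_ord _ _ _ lebesgue_measure m predT _ mJ tJ.
have /= -> := @measure_bigsetU_ord _ _ _ lebesgue_measure m predT _ mP tP.
apply: eq_bigr => i _; rewrite preimage_piece//.
exact: (lebesgue_measure_translation _ (mJ i)).
Qed.

End interval_exchange_theory.

(** * The flip map *)

(** The permutation k -> 1 - k mod r, extended to k = r, which stands for 0: the
    rotation by beta sends the end of [0, r) beyond r. *)
Definition flip_index (r k : nat) : nat :=
  if (k < 2)%N then (1 - k)%N else (r.+1 - k)%N.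

Definition flip_shift (R : realType) (r : nat) (beta : R) (k : nat) : R :=
  beta + (flip_index r k)%:R - k%:R.

Definition flip_cut (R : realType) (r : nat) (beta : R) (i : nat) : R :=
  if i == 0%N then 0 else if (i <= r)%N then i%:R - beta else r%:R.

Definition flip_map (R : realType) (r : nat) (beta x : R) : R :=
  x + flip_shift r beta (Num.truncn (x + beta)).

Section flip_map_theory.
Context (R : realType) (r : nat) (beta : R).

Local Notation T := (flip_map r beta).
Local Notation k_ x := (Num.truncn (x + beta)).
Local Notation s_ x := (x + beta - (k_ x)%:R).

Lemma flip_index_lt k : (2 < r)%N -> (k <= r)%N -> (flip_index r k < r)%N.
Proof. by rewrite /flip_index; case: ifP; lia. Qed.

Let floorP x : 0 < beta < 1 -> Ir R r x ->
  [/\ (k_ x)%:R <= x + beta, x + beta < (k_ x)%:R + 1 & (k_ x <= r)%N].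
Proof.
rewrite /Ir/= in_itv/= => b01 xr; have xb : 0 <= x + beta by lra.
have /andP[h1 h2] := truncn_itv xb; rewrite -natr1 in h2; split => //.
by rewrite truncn_le_nat -natr1; lra.
Qed.

Let floor_uniq x k : k%:R <= x + beta < k%:R + 1 -> k_ x = k.
Proof. by rewrite natr1 => /truncn_def. Qed.

Lemma flip_mapE x : T x = (flip_index r (k_ x))%:R + s_ x.
Proof. by rewrite /flip_map /flip_shift; ring. Qed.

Lemma flip_map_stable x : (2 < r)%N -> 0 < beta < 1 ->
  Ir R r x -> Ir R r (T x).
Proof.
move=> r3 b01 Ix; have [h1 h2 h3] := floorP b01 Ix.
rewrite /Ir/= in_itv/= flip_mapE.
have : ((flip_index r (k_ x)).+1%:R : R) <= r%:R.
  by rewrite ler_nat flip_index_lt.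
have : (0 : R) <= (flip_index r (k_ x))%:R by [].
rewrite -natr1; lra.
Qed.

Lemma flip_map_surj y : (2 < r)%N -> 0 < beta < 1 ->
  Ir R r y -> exists2 x, Ir R r x & T x = y.
Proof.
move=> r3 b01; rewrite /Ir/= in_itv/= => /andP[y0 yr].
have /andP[h1 h2] := truncn_itv y0; set j := Num.truncn y in h1 h2.
rewrite -natr1 in h2.
have jr : (j < r)%N by have := le_lt_trans h1 yr; rewrite ltr_nat.
have r3' : (3 : R) <= r%:R by rewrite ler_nat.
suff [k [kj kr]] : exists k, [/\ flip_index r k = j, 0 <= k%:R + (y - j%:R) - beta
    & k%:R + (y - j%:R) - beta < r%:R].
  exists (k%:R + (y - j%:R) - beta); first by rewrite in_itv/=; lra.
  by rewrite flip_mapE (@floor_uniq _ k) ?kj; lra.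
have [j0|j0] := eqVneq j 0%N.
  by exists 1%N; rewrite /flip_index /= j0 in h1 h2 *; split => //; lra.
(* both indices 0 and r lead to [1, 2): the unit interval that the rotation
   cuts at the end of [0, r) *)
have [j1|j1] := eqVneq j 1%N.
  have [sb|bs] := leP beta (y - j%:R).
    by exists 0%N; rewrite /flip_index /= j1 in sb h1 h2 *; split => //; lra.
  exists r; split; [by rewrite /flip_index; case: ifP; lia|lra|lra].
exists (r.+1 - j)%N; split; first by rewrite /flip_index; case: ifP; lia.
  have : (2 : R) <= (r.+1 - j)%N%:R by rewrite ler_nat; lia.
  lra.
have : ((r.+1 - j)%N%:R : R) <= r%:R - 1.
  by rewrite lerBrDr natr1 ler_nat; lia.
lra.
Qed.

Lemma flip_map_inj x y : 0 < beta < 1 ->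
  Ir R r x -> Ir R r y -> T x = T y -> x = y.
Proof.
move=> b01 Ix Iy; rewrite !flip_mapE => e.
have [x1 x2 xr] := floorP b01 Ix; have [y1 y2 yr] := floorP b01 Iy.
move: Ix Iy; rewrite /Ir/= !in_itv/= => Ix Iy.
have ke : flip_index r (k_ x) = flip_index r (k_ y).
  apply/eqP; rewrite eqn_leq; apply/andP.
  by split; rewrite -ltnS -(ltr_nat R) -[in ltRHS]natr1; lra.
have se : s_ x = s_ y by move: e; rewrite ke => /addrI.
have [kk|] : k_ x = k_ y \/ ((k_ x = 0%N /\ k_ y = r) \/ (k_ x = r /\ k_ y = 0%N)).
- clear - ke xr yr; move: ke; rewrite /flip_index; case: ifP; case: ifP; lia.
- by move: se; rewrite kk; lra.
- by case=> -[kx ky]; move: se; rewrite kx ky; lra.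
Qed.

Lemma flip_map_rotation x : exists p : int, T x = x + beta + p%:~R.
Proof.
exists ((flip_index r (k_ x))%:Z - (k_ x)%:Z).
by rewrite intrB -!pmulrn flip_mapE; ring.
Qed.

Lemma flip_map_translation x h : 0 < beta < 1 -> 0 <= x -> x + h <= r%:R ->
  (forall p : int, ~ (x + beta < p%:~R < x + beta + h)) ->
  forall t, 0 <= t < h -> T (x + t) = T x + t.
Proof.
move=> b01 x0 xh nop t th.
have Ix : Ir R r x by rewrite /Ir/= in_itv/=; lra.
have [h1 h2 _] := floorP b01 Ix.
suff kk : k_ (x + t) = k_ x by rewrite !flip_mapE kk; ring.
apply: floor_uniq; apply/andP; split; first lra.
rewrite ltNge; apply/negP => kt; apply: (nop ((k_ x)%:Z + 1)).
by rewrite intrD -pmulrn; lra.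
Qed.

Lemma flip_interval_exchange : (2 < r)%N -> 0 < beta < 1 ->
  interval_exchange r r.+1 T (flip_cut r beta) (flip_shift r beta).
Proof.
move=> r3 b01; have r3' : (3 : R) <= r%:R by rewrite ler_nat.
split.
- split.
  + by move=> x Ix; exact: flip_map_stable.
  + by move=> x y; rewrite !inE; exact: flip_map_inj.
  + by move=> y /(flip_map_surj r3 b01)[x Ix <-]; exists x.
- by rewrite /flip_cut eqxx /= ltnn; split.
- move=> i ir; rewrite /flip_cut /=.
  have : ((i.+1)%:R : R) <= r%:R + 1 by rewrite natr1 ler_nat.
  rewrite -natr1 => ir'.
  case: eqVneq => [->|i0]; first by case: ifP => _; lra.
  have -> : (i <= r)%N by [].
  case: ifP => [_|/negbT]; first by lra.
  rewrite -ltnNge ltnS => ri; have -> : i = r by lia.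
  by lra.
- move=> i ir x xi; rewrite /flip_map.
  congr (_ + flip_shift _ _ _); apply: floor_uniq; move: xi; rewrite in_itv/=.
  rewrite /flip_cut /=; have -> : (i <= r)%N by [].
  case: eqVneq => [->|i0].
    by case: ifP => [_|]; [lra|lia].
  case: ifP => [_|/negbT]; first by rewrite -natr1; lra.
  rewrite -ltnNge ltnS => ri; have -> : i = r by lia.
  by lra.
- move=> i ir; apply/eqP; rewrite /flip_shift -subr_eq0.
  rewrite -natr1 (_ : _ - _ =
    (flip_index r i).+1%:R - (flip_index r i.+1)%:R :> R); last first.
    by rewrite -natr1; ring.
  by rewrite subr_eq0 eqr_nat /flip_index; case: ifP; case: ifP; lia.
Qed.

Lemma flip_rotation_extension : (2 < r)%N -> 0 < beta < 1 ->
  rotation_extension r beta T.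
Proof.
move=> r3 b01; have iet := flip_interval_exchange r3 b01; split.
- by move=> x; exact: flip_map_stable.
- by move=> y; exact: flip_map_surj.
- by move=> x _; exact: flip_map_rotation.
- by move=> x h; exact: flip_map_translation.
- by move=> A mA; exact: (interval_exchange_measurable iet mA).
- exact: (interval_exchange_lebesgue iet).
Qed.

End flip_map_theory.

(** * The idoc condition *)

Lemma ziter_rotation (R : realType) (r : nat) (beta : R) (T : R -> R)
    (n : int) (x : R) : rotation_extension r beta T -> Ir R r x ->
  Ir R r (ziter r T n x) /\
  exists p : int, ziter r T n x = x + n%:~R * beta + p%:~R.
Proof.
move=> eT Ix; have Tsurj : set_surj (Ir R r) (Ir R r) T.
  by move=> y /(rext_surj eT)[z Iz <-]; exists z.
have pT y : Ir R r y -> Ir R r (pinv (Ir R r) T y) /\ T (pinv (Ir R r) T y) = y.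
  move=> Iy; split.
    by apply: (surjpinv_image_sub Tsurj); exists y.
  by apply: pinvK; rewrite inE; exact: Tsurj.
case: n => k; rewrite /ziter.
  elim: k => [|k [Ik [p xp]]]; first by split => //=; exists 0; lra.
  split; first exact: rext_stable eT _ Ik.
  have [q Tq] := rext_rotation eT Ik; exists (p + q).
  by rewrite iterS Tq xp intrD -!pmulrn -natr1; ring.
have step y : Ir R r y -> Ir R r (pinv (Ir R r) T y) /\
    exists p : int, pinv (Ir R r) T y = y - beta + p%:~R.
  move=> /pT[Iz Tz]; split => //; have [p yp] := rext_rotation eT Iz.
  by exists (- p); rewrite intrN -[in RHS]Tz yp; ring.
rewrite NegzE; elim: k => [|k [Ik [p xp]]].
  have [Iy [p yp]] := step x Ix; split => //; exists p => /=.
  by rewrite yp intrN; ring.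
have [Iy [q yq]] := step _ Ik; split => //; exists (p + q).
rewrite iterS yq xp intrD !intrN -!pmulrn -[in RHS]natr1; ring.
Qed.

Lemma ziter_inj (R : realType) (r : nat) (beta : R) (T : R -> R)
    (n : int) (x y : R) : rotation_extension r beta T ->
  set_inj (Ir R r) T -> Ir R r x -> Ir R r y ->
  ziter r T n x = ziter r T n y -> x = y.
Proof.
move=> eT Tinj Ix Iy; have Tsurj : set_surj (Ir R r) (Ir R r) T.
  by move=> z /(rext_surj eT)[w Iw <-]; exists w.
case: n => k; rewrite /ziter.
  elim: k => [//|k IH]; rewrite !iterS => e; apply: IH.
  apply: Tinj e; rewrite inE.
    exact: (ziter_rotation (Posz k) eT Ix).1.
  exact: (ziter_rotation (Posz k) eT Iy).1.
elim: k.+1 => [//|{}k IH]; rewrite !iterS => e; apply: IH.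
have inI (z : R) : Ir R r z -> iter k (pinv (Ir R r) T) z \in Ir R r.
  move=> Iz; rewrite inE; case: (k) => [//|k'].
  by have [] := ziter_rotation (Negz k') eT Iz.
by apply: (surjpinv_inj Tsurj) e; exact: inI.
Qed.

Lemma irrational_mulrz_inj (R : realType) (beta : R) (n n' p : int) :
  irrational beta -> n%:~R * beta = n'%:~R * beta + p%:~R -> n = n'.
Proof.
move=> irr e; apply: contrapT => nn'; apply: irr.
exists (p%:~R / (n - n')%:~R) => //=.
rewrite fmorph_div/= !ratr_int intrB.
have nz : n%:~R - n'%:~R != 0 :> R.
  by rewrite subr_eq0 eqr_int; apply/eqP.
have -> : p%:~R = beta * (n%:~R - n'%:~R).
  by rewrite mulrBr !(mulrC beta) e; ring.
by rewrite mulfK.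
Qed.

(** An orbit meets every coset of the integers at most once, because T^n moves
    points by n beta plus an integer; and all a i lie in the same coset. *)
Lemma rotation_extension_idoc (R : realType) (r m : nat) (beta : R)
    (T : R -> R) (a : nat -> R) :
  irrational beta -> rotation_extension r beta T -> set_inj (Ir R r) T ->
  (forall i, (0 < i < m)%N -> Ir R r (a i)) ->
  (forall i j, (0 < i < m)%N -> (0 < j < m)%N -> i <> j ->
    exists p : int, p != 0 /\ a i = a j + p%:~R) ->
  idoc r m T a.
Proof.
move=> irr eT Tinj aI aij; split.
  move=> i im orb_fin; apply: infinite_nat.
  have finZ : finite_set [set: int].
    have -> : [set: int] = (fun n => ziter r T n (a i)) @^-1` Defs.orbit r T (a i).
      by apply/seteqP; split => n // _; exists n.
    apply: finite_preimage => // n n' _ _ e.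
    have [_ [p np]] := ziter_rotation n eT (aI i im).
    have [_ [q nq]] := ziter_rotation n' eT (aI i im).
    apply: (irrational_mulrz_inj (p := q - p) irr).
    by move: e; rewrite np nq intrB; lra.
  have -> : [set: nat] = Posz @^-1` [set: int] by [].
  by apply: finite_preimage => // n n' _ _ [].
move=> i j im jm ij; apply/seteqP; split => // x [[n _ nx] [n' _ n'x]].
have [p [p0 ap]] := aij i j im jm ij.
have [_ [q nq]] := ziter_rotation n eT (aI i im).
have [_ [q' nq']] := ziter_rotation n' eT (aI j jm).
have nn' : n = n'.
  apply: (irrational_mulrz_inj (p := q' - q - p) irr).
  by move: nq nq'; rewrite nx n'x ap !intrB; lra.
rewrite -nn' -nx in n'x.
have := ziter_inj eT Tinj (aI j jm) (aI i im) n'x.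
rewrite ap => /eqP; rewrite -subr_eq0 opprD addrA subrr sub0r oppr_eq0 intr_eq0.
by apply/negP.
Qed.

(** * The eigenfunction *)

Lemma exp2ipiD (R : realType) (x y : R) :
  exp2ipi (x + y) = exp2ipi x * exp2ipi y.
Proof.
rewrite /exp2ipi mulrDr cosD sinD; apply/eqP; rewrite eq_complex /=.
by apply/andP; split; apply/eqP; ring.
Qed.

Lemma exp2ipi_int (R : realType) (p : int) : exp2ipi (p%:~R : R) = 1.
Proof.
have nat_case (k : nat) : exp2ipi (k%:R : R) = 1.
  rewrite /exp2ipi (_ : 2 * pi * k%:R = 0 + (pi *+ 2) *+ k); last first.
    by rewrite -mulr_natr -(mulr_natr pi) add0r; ring.
  rewrite (periodicn (@cosD2pi R)) (periodicn (@sinD2pi R)).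
  by rewrite cos0 sin0; apply/eqP; rewrite eq_complex /= !eqxx.
case: p => k; first exact: nat_case.
have := exp2ipiD (k.+1%:R : R) ((Negz k)%:~R).
rewrite nat_case mul1r => <-; rewrite NegzE intrN -pmulrn subrr.
exact: (nat_case 0%N).
Qed.

Lemma Re_normr_exp2ipi (R : realType) (x : R) :
  complex.Re `|exp2ipi x| ^+ 2 = 1.
Proof.
rewrite /exp2ipi normc_def /= sqr_sqrtr ?cos2Dsin2//.
Qed.

Lemma continuous_real_complex (R : realType) :
  continuous (real_complex R : R -> R[i]^o).
Proof.
move=> x; apply/cvgrPdist_lt => e e0.
have [Re_e Im_e] : 0 < complex.Re e /\ complex.Im e = 0.
  by move: e0; case: (e) => u v; rewrite ltcE /= => /andP[/eqP -> ->].
apply/nbhs_ballP; exists (complex.Re e) => //= t; rewrite /ball/= => xt.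
rewrite -rmorphB normc_def /= expr0n addr0 sqrtr_sqr ltcE /= xt andbT.
by rewrite Im_e.
Qed.

Lemma continuous_exp2ipi (R : realType) :
  continuous (@exp2ipi R : R -> R[i]^o).
Proof.
have expE (x : R) : exp2ipi x =
    real_complex R (cos (2 * pi * x)) + 'i * real_complex R (sin (2 * pi * x)).
  by rewrite [LHS]complexE complexiE.
move=> x; rewrite (_ : @exp2ipi R = fun x => real_complex R (cos (2 * pi * x)) +
    'i * real_complex R (sin (2 * pi * x))); last exact/funext.
have lin : {for x, continuous (fun x : R => 2 * pi * x)}.
  by apply: cvgM; [exact: cvg_cst|exact: cvg_id].
have ccos : {for x, continuous (fun x : R => cos (2 * pi * x))}.
  exact: (continuous_comp lin (@continuous_cos R _)).
have csin : {for x, continuous (fun x : R => sin (2 * pi * x))}.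
  exact: (continuous_comp lin (@continuous_sin R _)).
apply: cvgD.
  exact: (continuous_comp ccos (@continuous_real_complex R _)).
apply: cvgM; first exact: cvg_cst.
exact: (continuous_comp csin (@continuous_real_complex R _)).
Qed.

Lemma rotation_extension_eigenfunction (R : realType) (r : nat) (beta : R)
    (T : R -> R) : (0 < r)%N -> rotation_extension r beta T ->
  eigenfunction r T (exp2ipi beta) (@exp2ipi R : R -> R[i]^o).
Proof.
move=> r0 eT; have mI := @measurable_Ir R r; split.
- have mlin : measurable_fun setT (fun x : R => 2 * pi * x).
    by apply: measurable_funM.
  split.
  + apply: measurable_funTS; apply: (measurableT_comp _ mlin).
    exact: continuous_measurable_fun (@continuous_cos R).
  + apply: measurable_funTS; apply: (measurableT_comp _ mlin).
    exact: continuous_measurable_fun (@continuous_sin R).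
  + under eq_fun do rewrite Re_normr_exp2ipi.
    apply/integrableP; split; first exact: measurable_cst.
    rewrite (eq_integral (cst 1%E)); last by move=> x _ /=; rewrite normr1.
    by rewrite integral_cst//= mul1e lebesgue_Ir ltry.
- move=> [N [mN N0 sub]].
  have : (lebesgue_measure (Ir R r) <= lebesgue_measure N)%E.
    apply: le_measure; rewrite ?inE// => x Ix; apply: sub => /= H.
    have := Re_normr_exp2ipi x.
    by rewrite (H Ix) normr0 expr0n /= => /eqP; rewrite eq_sym oner_eq0.
  by rewrite N0 lebesgue_Ir lee_fin leNgt ltr0n r0.
- apply: aeW => x Ix; have [p ->] := rext_rotation eT Ix.
  by rewrite exp2ipiD exp2ipi_int mulr1 exp2ipiD mulrC.
Qed.

Lemma exp2ipi_not_constant (R : realType) (r : nat) : (0 < r)%N ->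
  ~ constant_on_Ir r (@exp2ipi R : R -> R[i]^o).
Proof.
move=> r0 [k fk]; have r1 : (1 : R) <= r%:R by rewrite ler1n.
have k0 := fk 0; have k2 := fk 2^-1.
rewrite /Ir/= !in_itv/= in k0 k2.
have {}k0 := k0 ltac:(lra); have {}k2 := k2 ltac:(lra).
move: k0; rewrite -k2 /exp2ipi mulr0 cos0 mulrAC mulfV// mul1r cospi => -[] /eqP.
by rewrite -subr_eq0 opprK => /eqP; lra.
Qed.

Unset Implicit Arguments.

Theorem mainTheorem1 (R : realType) (m : nat) (m_gt3 : (3 < m)%N)
    (beta : R) (beta01 : 0 <= beta <= 1) (beta_irr : irrational beta) :
  exists (r : nat) (T : R -> R) (a d : nat -> R),
    [/\ (0 < r)%N,
        interval_exchange r m T a d,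
        uniquely_ergodic r T,
        idoc r m T a
      & ~ topologically_weakly_mixing r T /\
        exists f : R -> R[i]^o,
          [/\ eigenfunction r T (exp2ipi beta) f,
              {within Ir R r, continuous f}
            & ~ constant_on_Ir r f]].
Proof.
have b01 : 0 < beta < 1.
  have b0 := irrational_mulrn_neq_int 0 beta_irr (ltn0Sn 0).
  have b1 := irrational_mulrn_neq_int 1 beta_irr (ltn0Sn 0).
  rewrite !mul1r in b0 b1; case/andP: beta01 => h0 h1.
  by rewrite !lt_neqAle h0 h1 b1 eq_sym b0.
case: m m_gt3 => // r; rewrite ltnS => r3.
have r0 : (0 < r)%N by exact: leq_trans r3.
have iet := flip_interval_exchange r3 b01.
have eT := flip_rotation_extension r3 b01.
have eig := rotation_extension_eigenfunction r0 eT.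
have cont : {within Ir R r, continuous (@exp2ipi R : R -> R[i]^o)}.
  exact: continuous_subspaceT (@continuous_exp2ipi R).
have ncst := @exp2ipi_not_constant R r r0.
exists r, (flip_map r beta), (flip_cut r beta), (flip_shift r beta).
split => //.
- exact: rotation_extension_uniquely_ergodic eT beta_irr r0.
- have cutE i : (0 < i < r.+1)%N -> flip_cut r beta i = i%:R - beta.
    by case/andP => i0 ir; rewrite /flip_cut gtn_eqF// -ltnS ir.
  apply: (rotation_extension_idoc beta_irr eT).
  + by case: iet => -[].
  + move=> i im; rewrite cutE// /Ir/= in_itv/=; case/andP: im => i0 ir.
    have : (1 : R) <= i%:R by rewrite ler1n.
    have : (i%:R : R) <= r%:R by rewrite ler_nat -ltnS.
    by lra.
  + move=> i j im jm ij; exists (i%:Z - j%:Z); split.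
      by rewrite subr_eq0; apply/eqP => -[].
    by rewrite !cutE// intrB -!pmulrn; ring.
- split; last by exists (@exp2ipi R).
  by move=> mix; apply: ncst; exact: mix eig cont.
Qed.
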